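(* Let $R$ be a ring and $a\in R$. If $a$ has Hirano inverse, then $a$ has Drazin inverse.
   Context: All rings are associative with identity. $N(R)$ denotes the set of all nilpotent elements of $R$. An element $a\in R$ has Hirano inverse if there exists $b\in R$ such that $a^2-ab\in N(R)$, $ab=ba$ and $b=bab$; such a $b$ is called a Hirano inverse of $a$. An element $a\in R$ has Drazin inverse if there exists $b\in R$ such that $a-a^2b\in N(R)$, $ab=ba$ and $b=bab$; such a $b$ is called the Drazin inverse of $a$. *)

(* Defs.v *)
From mathcomp Require Import all_boot all_algebra.

Set Implicit Arguments.
Unset Strict Implicit.
Unset Printing Implicit Defensive.

Import GRing.Theory.
Local Open Scope ring_scope.

(* [pzRingType] is used so that the zero ring is not excluded; there the
   exponent [n = 0] is harmless, and in a nonzero ring it is impossible. *)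
Definition nilpotent_elt (R : pzRingType) (x : R) : Prop :=
  exists n : nat, x ^+ n = 0.

Definition is_Hirano_inverse (R : pzRingType) (a b : R) : Prop :=
  [/\ nilpotent_elt (a ^+ 2 - a * b), a * b = b * a & b = b * a * b].

Definition has_Hirano_inverse (R : pzRingType) (a : R) : Prop :=
  exists b : R, is_Hirano_inverse a b.

Definition is_Drazin_inverse (R : pzRingType) (a b : R) : Prop :=
  [/\ nilpotent_elt (a - a ^+ 2 * b), a * b = b * a & b = b * a * b].

Definition has_Drazin_inverse (R : pzRingType) (a : R) : Prop :=
  exists b : R, is_Drazin_inverse a b.

(* Main.v *)
Require Import Defs.
From mathcomp Require Import all_boot all_algebra.

(** The Hirano inverse [b] of [a] is itself the Drazin inverse of [a].

    Since [b = b * a * b] and [a] commutes with [b], the product [e = a * b]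
    is an idempotent commuting with [a], and [a - a ^+ 2 * b = a * (1 - e)].
    Its square is [a ^+ 2 * (1 - e) = (a ^+ 2 - e) * (1 - e)], because
    [e * (1 - e) = 0].  This is a product of the nilpotent element [a ^+ 2 - e]
    with an element commuting with it, hence nilpotent; an element whose
    square is nilpotent is nilpotent. *)

Import GRing.Theory.
Local Open Scope ring_scope.

Lemma nilpotent_elt_mul_comm (R : pzRingType) (x y : R) :
  GRing.comm x y -> nilpotent_elt x -> nilpotent_elt (x * y).
Proof. by move=> cxy [n xn0]; exists n; rewrite exprMn_comm // xn0 mul0r. Qed.

Lemma nilpotent_elt_sqr (R : pzRingType) (x : R) :
  nilpotent_elt (x ^+ 2) -> nilpotent_elt x.
Proof. by move=> [n xn0]; exists (2 * n)%N; rewrite exprM. Qed.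

(** The factor [1 - e] removes the term [e] from [a ^+ 2 - e]: this is what
    trades the condition on [a ^+ 2 - e] for one on [a * (1 - e)]. *)
Lemma sqr_mul_idem_compl (R : pzRingType) (a e : R) :
  GRing.comm a e -> e * e = e ->
  (a * (1 - e)) ^+ 2 = (a ^+ 2 - e) * (1 - e).
Proof.
move=> cae ee.
have caf : GRing.comm a (1 - e) by apply: commrB => //; apply: commr1.
have ef0 : e * (1 - e) = 0 by rewrite mulrBr mulr1 ee subrr.
have ff : (1 - e) * (1 - e) = 1 - e by rewrite {1}mulrBl mul1r ef0 subr0.
by rewrite exprMn_comm // (expr2 (1 - e)) ff mulrBl ef0 subr0.
Qed.

Lemma Hirano_inverse_is_Drazin_inverse (R : pzRingType) (a b : R) :
  is_Hirano_inverse a b -> is_Drazin_inverse a b.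
Proof.
move=> [nil_w cab bab]; split=> //.
have cae : GRing.comm a (a * b) by apply: commrM.
have ee : a * b * (a * b) = a * b by rewrite -mulrA (mulrA b) -bab.
have -> : a - a ^+ 2 * b = a * (1 - a * b) by rewrite mulrBr mulr1 mulrA expr2.
apply: nilpotent_elt_sqr; rewrite sqr_mul_idem_compl //.
apply: nilpotent_elt_mul_comm nil_w.
apply: commrB; first exact: commr1.
apply/commr_sym/commrB => //.
exact/commrX/commr_sym.
Qed.

Theorem theorem2p1 (R : pzRingType) (a : R) :
  has_Hirano_inverse a -> has_Drazin_inverse a.
Proof.
by move=> [b Hb]; exists b; apply: Hirano_inverse_is_Drazin_inverse.
Qed.
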